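(* Let $\kappa$ be a regular uncountable cardinal and $\lambda\ge\kappa$ a cardinal with $\mathrm{cf}(\lambda)<\kappa$. Assume that either $\lambda$ is a strong limit cardinal, or at least for every cardinal $\mu$ with $\kappa\le\mu<\lambda$ there is a family of at most $\lambda$ clubs of $[\mu]^{<\kappa}$ such that every club of $[\mu]^{<\kappa}$ contains one of them. Then some club of $[\lambda]^{<\kappa}$ contains no unbounded non-stationary subset of $[\lambda]^{<\kappa}$.
   Context: For a set $A\supseteq\kappa$ (e.g. a cardinal or ordinal $\ge\kappa$), $[A]^{<\kappa}$ is the set of subsets of $A$ of cardinality $<\kappa$. For a model $\mathcal{M}$ with universe $A$ and countable vocabulary and $a\subseteq A$, $\mathrm{cl}_{\mathcal{M}}(a)$ denotes the closure of $a$ under the functions (including constants) of $\mathcal{M}$. A club of $[A]^{<\kappa}$ is a set of the form $\mathcal{C}_{\mathcal{M}}=\{a\in[A]^{<\kappa}: a=\mathrm{cl}_{\mathcal{M}}(a)\ \wedge\ a\cap\kappa\in\kappa\}$ for some model $\mathcal{M}$ with universe $A$ and countable vocabulary. The club filter on $[A]^{<\kappa}$ is the filter generated by the clubs. A set $S\subseteq[A]^{<\kappa}$ is stationary if its complement in $[A]^{<\kappa}$ is not in the club filter, and non-stationary otherwise. A set $S\subseteq[A]^{<\kappa}$ is unbounded if every member of $[A]^{<\kappa}$ is contained in some member of $S$. *)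

(* Defs.v *)
From mathcomp Require Import all_boot all_order.
From mathcomp Require Import boolp classical_sets functions cardinality filter.
From mathcomp Require wochoice.

Set Implicit Arguments.
Unset Strict Implicit.
Unset Printing Implicit Defensive.

Import Order.TTheory.

Local Open Scope classical_set_scope.
Local Open Scope card_scope.
Local Open Scope order_scope.

(* Ordinals are represented as elements of an arbitrary well-ordered type [T],
   the ordinal [a] being identified with the set [below a] of its
   predecessors. Every ordinal l of set theory occurs as an element of such a
   type (take T to be l + 1), and each notion below depends only on [below] of
   the ordinals it is applied to, so nothing is lost by fixing [T]. *)

Definition card_lt T U (A : set T) (B : set U) : Prop :=
  (A #<= B) /\ ~ (B #<= A).

Section Ordinals.
Context {d : Order.disp_t} {T : orderType d}.
Implicit Types (a b c k l m : T).

Definition below a : set T := [set x | x < a].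

Definition is_cardinal k : Prop :=
  forall a, a < k -> ~ (below a #= below k).

(* Some function from c to a has unbounded range in a. *)
Definition has_cofinal_map a c : Prop :=
  exists f : T -> T,
    (forall x, x < c -> f x < a) /\
    (forall b, b < a -> exists2 x, x < c & b <= f x).

(* cf(a) = c *)
Definition is_cofinality a c : Prop :=
  has_cofinal_map a c /\ (forall b, has_cofinal_map a b -> c <= b).

Definition is_regular_cardinal k : Prop :=
  [/\ is_cardinal k, infinite_set (below k) & is_cofinality k k].

(* 2^m < l for every cardinal m < l *)
Definition is_strong_limit l : Prop :=
  is_cardinal l /\
  (forall m, is_cardinal m -> m < l ->
    card_lt [set X : set T | X `<=` below m] (below l)).

End Ordinals.

Record vocabulary := Vocabulary {
  fsym : countType;
  farity : fsym -> nat;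
  rsym : countType;
  rarity : rsym -> nat }.

Definition tuples_in T (A : set T) n : set (n.-tuple T) :=
  [set t | forall i : 'I_n, A (tnth t i)].

(* Models with universe the set [A]: function symbols are interpreted by total
   functions on the ambient type that map tuples from A into A; their values on
   other tuples are irrelevant. Constants are the function symbols of arity 0. *)
Record model (T : Type) (V : vocabulary) (A : set T) := Model {
  fint : forall f : fsym V, (farity f).-tuple T -> T;
  fintP : forall (f : fsym V) (t : (farity f).-tuple T),
    tuples_in A t -> A (fint t);
  rint : forall r : rsym V, set ((rarity r).-tuple T);
  rintP : forall (r : rsym V) (t : (rarity r).-tuple T),
    rint t -> tuples_in A t }.

Section Clubs.
Context {d : Order.disp_t} {T : orderType d}.
Implicit Types (k : T) (A a : set T) (S C : set (set T)).

Definition closed_under (V : vocabulary) A (M : model V A) : set (set T) :=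
  [set b | forall (f : fsym V) (t : (farity f).-tuple T),
     tuples_in b t -> b (fint M t)].

Definition cl (V : vocabulary) A (M : model V A) a : set T :=
  smallest (closed_under M) a.

(* [A]^{<k} *)
Definition subsets_lt k A : set (set T) :=
  [set a | a `<=` A /\ card_lt a (below k)].

(* The condition "a :&: k \in k" says that a :&: k is an ordinal below k. *)
Definition club_of k (V : vocabulary) A (M : model V A) : set (set T) :=
  [set a | [/\ subsets_lt k A a, a = cl M a &
     exists2 c, c < k & a `&` below k = below c]].

Definition is_club k A C : Prop :=
  exists (V : vocabulary) (M : model V A), C = club_of k M.

(* This is the generated filter on the whole powerset of T. Since clubs are
   included in [A]^{<k}, a subset of [A]^{<k} belongs to it if and only if it
   belongs to the filter on [A]^{<k} generated by the clubs. *)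
Definition club_filter k A : set_system (set T) :=
  smallest (@Filter (set T)) (is_club k A).

Definition is_stationary k A S : Prop :=
  S `<=` subsets_lt k A /\ ~ club_filter k A (subsets_lt k A `\` S).

Definition is_nonstationary k A S : Prop :=
  S `<=` subsets_lt k A /\ ~ is_stationary k A S.

Definition is_unbounded k A S : Prop :=
  S `<=` subsets_lt k A /\
  (forall a, subsets_lt k A a -> exists2 b, S b & a `<=` b).

(* At most l clubs of [A]^{<k} such that every club contains one of them. *)
Definition has_club_base k A (l : T) : Prop :=
  exists F : set (set (set T)),
    [/\ F #<= below l,
        (forall C, F C -> is_club k A C) &
        (forall C, is_club k A C -> exists2 D, F D & D `<=` C)].

End Clubs.

(* Main.v *)
(* Fix beta_i < lambda (i < theta = cf(lambda)) cofinal in lambda. Clubs are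
   given by operations, and for each i every club of [beta_i]^{<kappa} contains
   one named by an ordinal c < lambda (counting iterated power sets when lambda
   is a strong limit). Let C be a club whose members a contain theta as a subset
   and satisfy: if c in a and i < theta, then a :&: beta_i is in the club named
   by c and i. Given any club E of [lambda]^{<kappa}, restrict its operations to
   each beta_i, discarding values outside beta_i, and let c_i name a club below
   this restriction. If a in C contains all the c_i, then each a :&: beta_i is
   closed under the restricted operations; since an application of an operation
   of E involves finitely many ordinals, all below some beta_i, a is in E. There
   are fewer than kappa ordinals c_i, so an unbounded subset of C has a member
   containing them all, and it meets E.
   The hypothesis on clubs concerns cardinals only, so one works with
   mu_i = |beta_i| and lets C be closed under injections beta_i -> mu_i and
   their inverses. *)

Require Import Defs.
From HB Require Import structures.
From mathcomp Require Import all_boot all_order.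
From mathcomp Require Import boolp classical_sets functions cardinality filter.
From mathcomp Require wochoice.

Local Open Scope classical_set_scope.
Local Open Scope order_scope.
Local Open Scope card_scope.

Set Implicit Arguments.
Unset Strict Implicit.
Unset Printing Implicit Defensive.

Import Order.TTheory.

(** * Cardinality in a well-ordered type *)

Lemma card_le_injP {U V : Type} (v0 : V) (A : set U) (B : set V) :
  (A #<= B) <-> exists f : U -> V, (forall x, A x -> B (f x)) /\
    (forall x y, A x -> A y -> f x = f y -> x = y).
Proof.
have @Vp : pointedType := HB.pack V (gen_eqMixin V) (gen_choiceMixin V)
  (isPointed.Build V v0).
split.
  move=> /(@pcard_leP U Vp) /injfunPex[f fAB finj]; exists f; split=> // x y Ax Ay.
  by apply: finj; rewrite inE.
move=> [f [fAB finj]]; apply/(@pcard_leP U Vp)/injfunPex; exists f => //.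
by move=> x y /set_mem Ax /set_mem Ay; apply: finj.
Qed.

Section WellOrder.
Context {d : Order.disp_t} {T : orderType d}.
Hypothesis T_wo : wochoice.well_order (fun x y : T => x <= y).
Implicit Types (a b k l m x y : T) (P : set T).

Lemma exists_least P x : P x -> exists2 m, P m & forall y, P y -> m <= y.
Proof.
move=> Px; have [|m [[mP mle] _]] := T_wo (A := fun y => `[< P y >]).
  by exists x; apply/asboolP.
exists m; first exact/asboolP.
by move=> y Py; apply: mle; apply/asboolP.
Qed.

Lemma well_founded_lt : well_founded (fun x y : T => x < y).
Proof.
move=> x; apply: contrapT => nx.
have [m nm mle] := @exists_least (fun x => ~ Acc (fun x y : T => x < y) x) x nx.
apply: nm; split=> y ym; apply: contrapT => /mle.
by rewrite leNgt ym.
Qed.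

Lemma exists_cardinal b : exists m, [/\ is_cardinal m, m <= b & below b #<= below m].
Proof.
have [m bm mle] := @exists_least [set m | below b #<= below m] b (card_lexx _).
exists m; split=> //; last by apply: mle; exact: card_lexx.
move=> a am /card_eqPle[_ /(card_le_trans bm) /mle].
by rewrite leNgt am.
Qed.

(** Recursion along [T] picks a new element of [X] at each stage. If none is left at a stage
    [a < l], then [X] lies in the image of [below a]; otherwise the choices form an injection. *)
Lemma card_le_below_or {U : choiceType} (u0 : U) (X : set U) l :
  (exists2 a, a < l & X #<= below a) \/ below l #<= X.
Proof.
have [[a al Xa]|nX] := pselect (exists2 a, a < l & X #<= below a).
  by left; exists a.
right; apply/(card_le_injP u0).
pose step a (g : forall b, b < a -> U) : U :=
  xget u0 [set x | X x /\ forall b (ba : b < a), g b ba <> x].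
pose g := Fix well_founded_lt (fun=> U) step.
have gE a : g a = xget u0 [set x | X x /\ forall b, b < a -> g b <> x].
  rewrite {1}/g Fix_eq // => x f1 f2 f12; congr (step _ _).
  by apply: functional_extensionality_dep => y; apply: functional_extensionality_dep.
have gP a : a < l -> X (g a) /\ forall b, b < a -> g b <> g a.
  move=> al; rewrite gE; case: xgetP => [x _ [Xx xg]|none]; first by split.
  exfalso; apply: nX; exists a => //.
  apply: (card_le_trans _ (card_image_le g (below a))).
  apply: subset_card_le => x Xx; apply: contrapT => nx; apply: (none x); split => //.
  by move=> b ba gbx; apply: nx; exists b.
exists g; split=> [x /gP[]//|x y xl yl gxy].
case: (ltgtP x y) => // xy; exfalso.
  by have [_ /(_ _ xy)] := gP _ yl; apply.
by have [_ /(_ _ xy)] := gP _ xl; apply.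
Qed.

(** For a cardinal [l] this means cardinality less than [l]. *)
Definition small {U : Type} l (X : set U) := exists2 a, a < l & X #<= below a.

(** [X] injects into [below m] for a cardinal [m < l], hence its power set into that of [below m].
    As [below l] does not inject into the latter, comparability yields a bound below [l]. *)
Lemma strong_limit_small_powerset {U : Type} l (X : set U) :
  is_strong_limit l -> small l X -> small l [set Y | Y `<=` X].
Proof.
move=> [_ pow] [a al Xa]; have [m [cm ma am]] := exists_cardinal a.
have ml : m < l by apply: le_lt_trans ma al.
have /(card_le_injP m)[f [fm finj]] := card_le_trans Xa am.
have [_ npow] := pow m cm ml.
have powX : [set Y | Y `<=` X] #<= [set Y : set T | Y `<=` below m].
  apply/(card_le_injP set0); exists (fun Y => f @` Y); split.
    by move=> Y YX _ [x /YX Xx <-]; apply: fm.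
  have sub Y Z : Y `<=` X -> Z `<=` X -> f @` Y = f @` Z -> Y `<=` Z.
    move=> YX ZX fYZ x Yx; have [y Zy fyx] : (f @` Z) (f x) by rewrite -fYZ; exists x.
    by rewrite -(finj y x) //; [apply: ZX|apply: YX].
  by move=> Y Z YX ZX fYZ; apply/seteqP; split; apply: sub.
have [[b bl Pb]|//] := @card_le_below_or _ set0 [set Y : set T | Y `<=` below m] l.
by exists b => //; apply: card_le_trans Pb.
Qed.

(** If [b] were the largest ordinal below [l], sending [b] to [e 0], each [e n] to [e n.+1] and
    fixing the rest would inject [below l] into [below b]. *)
Lemma infinite_cardinal_limit l b : is_cardinal l -> infinite_set (below b) ->
  b < l -> exists2 b', b' < l & b < b'.
Proof.
move=> cl /infiniteP /(card_le_injP b)[e [eb einj']] bl.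
have einj : injective e by move=> m n; apply: einj'.
apply: contrapT => nb; apply: (cl b bl); apply/card_eqPle; split.
  by apply: subset_card_le => x; rewrite /below/= => xb; apply: lt_trans bl.
have xb x : x < l -> x <= b.
  by move=> xl; rewrite leNgt; apply/negP => bx; apply: nb; exists x.
pose p x := exists n, x = e n.
pose F x := if x == b then e 0 else
  if pselect (p x) is left px then e (projT1 (cid px)).+1 else x.
have ebN n : e n != b by apply/negP => /eqP enb; have := eb n I; rewrite /below/= enb ltxx.
have Fe n : F (e n) = e n.+1.
  rewrite /F (negbTE (ebN n)); case: pselect => [px|[]]; last by exists n.
  by case: (cid px) => m /= /einj ->.
have Fb : F b = e 0 by rewrite /F eqxx.
have Fn x : x != b -> ~ p x -> F x = x.
  by move=> xb' npx; rewrite /F (negbTE xb'); case: pselect.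
have cases x : x < l -> [\/ x = b, exists n, x = e n | [/\ x < b, ~ p x & F x = x]].
  move=> xl; have [->|xNb] := eqVneq x b; first by constructor 1.
  have [px|npx] := pselect (p x); first by constructor 2.
  by constructor 3; split=> //; [rewrite lt_neqAle xNb xb|apply: Fn].
apply/(card_le_injP b); exists F; split.
  move=> x /cases[->|[n ->]|[xb' _ ->]] //; first by rewrite Fb; apply: eb.
  by rewrite Fe; apply: eb.
move=> x y /cases[->|[n ->]|[xb' npx ->]] /cases[->|[n' ->]|[yb' npy ->]] //.
- by rewrite Fb Fe => /einj; case.
- by rewrite Fb => y0; case: npy; exists 0.
- by rewrite Fe Fb => /einj; case.
- by rewrite !Fe => /einj [->].
- by rewrite Fe => y0; case: npy; exists n.+1.
- by rewrite Fb => y0; case: npx; exists 0.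
- by rewrite Fe => y0; case: npx; exists n'.+1.
Qed.

End WellOrder.

(** * Clubs as closure under operations on finite sequences *)

Section Operations.
Context {d : Order.disp_t} {T : orderType d}.
Implicit Types (k x y : T) (A a b : set T) (s : seq T).

(** Each operation takes sequences of any length, so one such family codes any countable
    vocabulary. *)
Definition ops := nat -> seq T -> T.

(* Values outside [A] are ignored, so [o] acts as a family of partial
   operations on [A]. *)
Definition opclosed A (o : ops) : set (set T) :=
  [set b | forall n s, (forall x, x \in s -> b x) -> A (o n s) -> b (o n s)].

Definition clubops k A (o : ops) : set (set T) :=
  [set a | [/\ subsets_lt k A a, opclosed A o a &
     exists2 c, c < k & a `&` below k = below c]].

Lemma club_of_closed k V A (M : model V A) a :
  club_of k M a -> closed_under M a.
Proof.
move=> [_ -> _] f t tcl b bP; case: (bP) => bM _.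
by apply: bM => i; apply: (tcl i b bP).
Qed.

Lemma clubops_sub_club k A C (x0 : T) :
  is_club k A C -> exists o, clubops k A o `<=` C.
Proof.
move=> [V [M ->]].
(* Operation [n] is the symbol coded by [n]. The default [x0] can only add closure conditions, hence
   an inclusion. *)
pose o : ops := fun n s =>
  if @unpickle (Defs.fsym V) n is Some f then
    if @insub _ _ ((farity f).-tuple T) s is Some t then fint M t else x0
  else x0.
exists o => a [[aA alt] ao ak]; split=> //.
rewrite /cl smallest_id // => f t ta.
have oE : o (pickle f) t = fint M t by rewrite /o pickleK valK.
rewrite -oE; apply: ao; last by rewrite oE; apply: fintP => i; apply: aA.
by move=> x /tnthP[i ->].
Qed.

Definition nat_vocabulary : vocabulary :=
  Vocabulary (fun p : nat * nat => p.2) (fun _ : void => 0).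

Lemma club_sub_clubops k A (o : ops) : A !=set0 ->
  exists2 C, is_club k A C & C `<=` clubops k A o.
Proof.
move=> [x0 Ax0].
pose F (f : Defs.fsym nat_vocabulary) (t : (farity f).-tuple T) : T :=
  if pselect (A (o f.1 t)) then o f.1 t else x0.
have FP f t : tuples_in A t -> A (F f t) by rewrite /F; case: pselect.
pose M := @Model T nat_vocabulary A F FP (fun=> set0) (fun r => match r with end).
exists (club_of k M); first by exists nat_vocabulary, M.
move=> a Ca; have aM := club_of_closed Ca; case: Ca => alt _ ak; split=> // n s sa Ao.
have := aM (n, size s) (in_tuple s); rewrite /= /F; case: pselect => //= _; apply.
by move=> i; apply: sa; exact: mem_tnth.
Qed.

Definition vocabulary_sum (V W : vocabulary) : vocabulary :=
  @Vocabulary (Defs.fsym V + Defs.fsym W)%type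
    (fun f => match f with inl f => farity f | inr f => farity f end)
    (rsym V + rsym W)%type
    (fun r => match r with inl r => rarity r | inr r => rarity r end).

Lemma is_clubI k A C D : is_club k A C -> is_club k A D -> is_club k A (C `&` D).
Proof.
move=> [V [M ->]] [W [N ->]].
pose F (f : Defs.fsym (vocabulary_sum V W)) : (farity f).-tuple T -> T :=
  match f with inl f => @fint _ _ _ M f | inr f => @fint _ _ _ N f end.
have FP f t : tuples_in A t -> A (F f t) by case: f t => f t; [apply: (@fintP _ _ _ M f t)|apply: (@fintP _ _ _ N f t)].
pose R (r : rsym (vocabulary_sum V W)) : set ((rarity r).-tuple T) :=
  match r with inl r => @rint _ _ _ M r | inr r => @rint _ _ _ N r end.
have RP r t : R r t -> tuples_in A t by case: r t => r t; [apply: (@rintP _ _ _ M r t)|apply: (@rintP _ _ _ N r t)].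
exists (vocabulary_sum V W), (Model FP RP); apply/seteqP; split=> a.
  move=> [Ma Na]; have clM := club_of_closed Ma; have clN := club_of_closed Na.
  case: Ma => alt _ ak; split=> //.
  by rewrite /cl smallest_id // => -[f|f] t; [apply: clM|apply: clN].
move=> Pa; have cla := club_of_closed Pa; case: Pa => alt _ ak.
by split; split => //; rewrite /cl smallest_id // => f t;
  [apply: (cla (inl f))|apply: (cla (inr f))].
Qed.

(** As clubs are closed under intersection, the sets containing a club already form a filter. *)
Lemma club_filterP k A X : A !=set0 ->
  club_filter k A X -> exists2 C, is_club k A C & C `<=` X.
Proof.
move=> A0 clX; apply: (clX [set X | exists2 C, is_club k A C & C `<=` X]).
split; last by move=> C Cclub; exists C.
split.
- have [C Cclub _] := @club_sub_clubops k A (fun _ _ => k) A0; by exists C.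
- move=> X1 X2 [C1 C1club CX1] [C2 C2club CX2]; exists (C1 `&` C2).
    exact: is_clubI.
  by move=> a [/CX1 ? /CX2].
- by move=> X1 X2 X12 [C Cclub CX1]; exists C => // a /CX1/X12.
Qed.

End Operations.

(** * Naming clubs by ordinals *)

Section Codes.
Context {d : Order.disp_t} {T : orderType d}.
Hypothesis T_wo : wochoice.well_order (fun x y : T => x <= y).
Implicit Types (k l m x y : T) (s : seq T).

Definition club_codes k A l (D : T -> ops) :=
  forall o : ops, exists2 c, c < l & clubops k A (D c) `<=` clubops k A o.

Lemma club_base_codes k A l : A !=set0 -> has_club_base k A l ->
  exists D : T -> ops, club_codes k A l D.
Proof.
move=> A0 [F [/(card_le_injP k)[f [fl finj]] Fclub Fbase]].
have /choice[e eP] C : exists o : ops, F C -> clubops k A o `<=` C.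
  have [/Fclub/(clubops_sub_club k)[o oC]|nF] := pselect (F C); first by exists o.
  by exists (fun _ _ => k).
(* [g] inverts [f] on [F]: an ordinal names the member of [F] that [f] sends to it. *)
have /choice[g gP] c : exists C, (exists2 C', F C' & f C' = c) -> F C /\ f C = c.
  have [[C FC fC]|nC] := pselect (exists2 C', F C' & f C' = c); first by exists C.
  by exists set0.
exists (e \o g) => o; have [C Cclub Co] := @club_sub_clubops _ _ k A o A0.
have [B FB BC] := Fbase _ Cclub; exists (f B); first exact: fl.
have [|FG fG] := gP (f B); first by exists B.
have gB : g (f B) = B by apply: finj.
by apply: subset_trans Co; apply: subset_trans BC; rewrite /= gB; apply: eP.
Qed.

(* Kuratowski's ordered pair. *)
Definition kpair x y : set (set T) := [set [set x]; [set x; y]].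

Lemma kpair_inj x y x' y' : kpair x y = kpair x' y' -> x = x' /\ y = y'.
Proof.
have sub z z' : kpair x z = kpair x z' -> z = x \/ z = z'.
  move=> zz'; have : kpair x z' [set x; z] by rewrite -zz'; right.
  by case=> xz; have : [set x; z] z by [right]; rewrite xz; [left|].
move=> xy; have xx' : x = x'.
  have : kpair x y [set x'] by rewrite xy; left.
  case=> x'E; first by have -> : x' = x by have : [set x'] x' by []; rewrite x'E.
  by have : [set x'] x by rewrite x'E; left.
subst x'; split=> //.
by have [yx|//] := sub _ _ xy; have [y'x|//] := sub _ _ (esym xy); rewrite yx y'x.
Qed.

(** The points [e n] stand for the natural numbers, so [s] becomes a set built over [T] by iterated
    power sets. *)
Definition graph_of_seq (e : nat -> T) s : set (set (set T)) :=
  [set kpair (e n) (nth (e 0) s n) | n in [set n | (n < size s)%N]].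

Lemma graph_of_seq_inj (e : nat -> T) : injective e -> injective (graph_of_seq e).
Proof.
move=> einj.
have sub s s' : graph_of_seq e s = graph_of_seq e s' ->
    forall n, (n < size s)%N -> (n < size s')%N /\ nth (e 0) s n = nth (e 0) s' n.
  move=> ss' n ns; have : graph_of_seq e s (kpair (e n) (nth (e 0) s n)) by exists n.
  by rewrite ss' => -[n' n's' /kpair_inj[/einj <- ->]].
move=> s s' ss'; have szs : size s = size s'.
  apply/eqP; rewrite eqn_leq; apply/andP; split; rewrite leqNgt; apply/negP.
    by move=> /(sub _ _ ss')[]; rewrite ltnn.
  by move=> /(sub _ _ (esym ss'))[]; rewrite ltnn.
by apply: (eq_from_nth (x0 := e 0) szs) => n /(sub _ _ ss')[].
Qed.

Lemma graph_of_seq_sub (e : nat -> T) (X : set T) s :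
  (forall n, X (e n)) -> (forall x, x \in s -> X x) ->
  graph_of_seq e s `<=` [set Z | Z `<=` [set Y | Y `<=` X]].
Proof.
move=> eX sX _ [n ns <-] Y [->|->] x; first by move=> ->.
by case=> -> //; apply: sX; rewrite mem_nth.
Qed.

(** Partial operations on [below m] are determined by their graph, an element of the fourth iterated
    power set of [below m]. This power set injects into [below a] for some [a < l], which supplies
    the names. *)
Lemma strong_limit_codes k m l : is_strong_limit l -> infinite_set (below m) ->
  m < l -> exists D : T -> ops, club_codes k (below m) l D.
Proof.
move=> ls /infiniteP/(card_le_injP m)[e [/(_ _ I) em einj']] ml.
have einj : injective e by move=> x y; apply: einj'.
(* One sequence records the index, the value and the arguments; only values and arguments below [m]
   are kept. *)
pose graph (o : ops) := [set z | exists n s,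
  [/\ z = graph_of_seq e (e n :: o n s :: s), below m (o n s) &
      forall x, x \in s -> below m x]].
have pow U (X : set U) := @strong_limit_small_powerset _ _ T_wo U l X ls.
have : small l (below m) by exists m => //; apply: card_lexx.
move=> /pow/pow/pow/pow[a al /(card_le_injP m)[f [fa finj]]].
have graphP o : [set Y | Y `<=` [set Z | Z `<=` [set Y | Y `<=` [set Y | Y `<=` below m]]]] (graph o).
  move=> z [n [s [-> om sm]]]; apply: graph_of_seq_sub => // x.
  by rewrite !inE => /or3P[/eqP ->|/eqP ->|/sm].
have /choice[D DP] c : exists o, (exists o', f (graph o') = c) -> f (graph o) = c.
  have [[o fo]|no] := pselect (exists o', f (graph o') = c); first by exists o.
  by exists (fun _ _ => m).
exists D => o; exists (f (graph o)); first by apply: lt_trans (fa _ (graphP o)) al.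
have Dgraph : graph (D (f (graph o))) = graph o.
  by apply: finj; [exact: graphP|exact: graphP|apply: DP; exists o].
move=> b [blt bD bk]; split=> // n s sb om.
have : graph o (graph_of_seq e (e n :: o n s :: s)).
  by exists n, s; split=> // x /sb; case: blt => + _; apply.
rewrite -Dgraph => -[n' [s' [/(graph_of_seq_inj einj)[/einj <- oD ss'] Dm s'm]]].
by rewrite oD -ss'; apply: bD => //; rewrite ss'.
Qed.

End Codes.

(** * The club with its named operations, and the diagonal argument *)

Theorem theorem2p2 (d : Order.disp_t) (T : orderType d)
    (T_wo : wochoice.well_order (fun x y : T => x <= y))
    (kappa lambda : T)
    (kappa_regular : is_regular_cardinal kappa)
    (kappa_uncountable : ~ countable (below kappa))
    (lambda_cardinal : is_cardinal lambda)
    (kappa_le_lambda : kappa <= lambda)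
    (cf_lambda : exists2 c : T, is_cofinality lambda c & c < kappa)
    (few_clubs : is_strong_limit lambda \/
       (forall mu : T, is_cardinal mu -> kappa <= mu -> mu < lambda ->
          has_club_base kappa (below mu) lambda)) :
  exists2 C : set (set T), is_club kappa (below lambda) C &
    ~ (exists S : set (set T),
         [/\ S `<=` C,
             is_unbounded kappa (below lambda) S &
             is_nonstationary kappa (below lambda) S]).
Proof.
have [kappa_cardinal kappa_inf [_ kappa_cf]] := kappa_regular.
have [theta [[f [flt fcof]] _] theta_kappa] := cf_lambda.
have kappa_lambda : kappa < lambda.
  rewrite lt_neqAle kappa_le_lambda andbT; apply/negP => /eqP kl.
  have : kappa <= theta by apply: kappa_cf; rewrite kl; exists f.
  by rewrite leNgt theta_kappa.
have sub_below (x y : T) : x <= y -> below x `<=` below y.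
  by move=> xy z zx; apply: lt_le_trans xy.
have inf_below (x : T) : kappa <= x -> infinite_set (below x).
  by move=> /sub_below kx; apply: sub_infinite_set kx kappa_inf.
(* The maximum with [kappa] makes the cardinals [mu i] at least [kappa]. *)
pose beta i := if i < theta then Order.max kappa (f i) else kappa.
have beta_lt i : beta i < lambda.
  by rewrite /beta; case: ifP => // itheta; rewrite gt_max kappa_lambda flt.
have beta_ge i : kappa <= beta i by rewrite /beta; case: ifP; rewrite ?le_max ?lexx.
have beta_cof (s : seq T) : (forall x, x \in s -> x < lambda) ->
    exists2 i, i < theta & forall x, x \in s -> x < beta i.
  (* Cofinality gives only [b <= f i], so a strict bound [b] of [s] is found first; it exists as
     [lambda] is a limit. *)
  move=> sl; suff [b bl sb] : exists2 b, b < lambda & forall x, x \in s -> x < b.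
    have [i itheta bi] := fcof _ bl; exists i => // x /sb xb.
    by rewrite /beta itheta lt_max (lt_le_trans xb bi) orbT.
  elim: s sl => [|y s IHs] sl; first by exists kappa.
  have [|b bl sb] := IHs; first by move=> x xs; apply: sl; rewrite inE xs orbT.
  have yl : y < lambda by apply: sl; rewrite mem_head.
  have Ml : Order.max kappa (Order.max y b) < lambda by rewrite !gt_max kappa_lambda yl.
  have [|b' b'l] := infinite_cardinal_limit lambda_cardinal _ Ml.
    by apply: inf_below; rewrite le_max lexx.
  rewrite !gt_max => /and3P[_ yb' bb']; exists b' => // x.
  by rewrite inE => /orP[/eqP -> //|/sb xb]; apply: lt_trans bb'.
have /choice[mu muP] i := exists_cardinal T_wo (beta i).
have mu_ge i : kappa <= mu i.
  have [mu_card mu_beta /(card_le_trans (subset_card_le (sub_below _ _ (beta_ge i)))) kmu] := muP i.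
  rewrite leNgt; apply/negP => muk; apply: (kappa_cardinal _ muk).
  by apply/card_eqPle; split=> //; apply/subset_card_le/sub_below/ltW.
have mu_lt i : mu i < lambda by have [_ /le_lt_trans ->] := muP i.
have /choice[h hP] i : exists h : T -> T, (forall x, x < beta i -> h x < mu i) /\
    (forall x y, x < beta i -> y < beta i -> h x = h y -> x = y).
  by have [_ _ /(card_le_injP kappa)] := muP i.
have /choice[g gP] i : exists g : T -> T, forall x, x < beta i -> g (h i x) = x.
  have [_ hinj] := hP i.
  exists (fun y => xget y [set x | x < beta i /\ h i x = y]) => x xb.
  by case: xgetP => [y _ [yb]|/(_ x)]; [exact: hinj|case].
have /choice[D DP] i : exists D, club_codes kappa (below (mu i)) lambda D.
  case: few_clubs => [sl|base].
    exact/(strong_limit_codes T_wo _ sl)/mu_lt/inf_below/mu_ge.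
  apply: club_base_codes; first exact/infinite_setN0/inf_below/mu_ge.
  by apply: base => //; have [] := muP i.
(* The index [i] is passed as an argument, so countably many operations serve all [i < theta].
   Operation 0 puts [theta] in every member, 1 and 2 apply [h i] and [g i], and [n.+3] applies
   operation [n] of the club named by [c] for [mu i]. *)
pose O : ops := fun n s =>
  match n, s with
  | 0, _ => theta
  | 1, [:: i; x] => h i x
  | 2, [:: i; x] => g i x
  | n.+3, i :: c :: s => D i c n s
  | _, _ => kappa
  end.
have [|C Cclub CO] := @club_sub_clubops _ _ kappa (below lambda) O.
  by exists kappa.
exists C => //; move=> [S [SC [Slt Sunb] [_ Snst]]].
(* [S] is shown stationary: a club [E] disjoint from [S] leads to a contradiction. *)
apply: Snst; split=> // /club_filterP[|E Eclub ES]; first by exists kappa.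
have [o oE] := clubops_sub_club kappa Eclub.
(* The operations [o], carried from [beta i] to [mu i] along [h i]. *)
pose N i : ops := fun n s => h i (o n (map (g i) s)).
have /choice[code codeP] i : exists c, c < lambda /\
    clubops kappa (below (mu i)) (D i c) `<=` clubops kappa (below (mu i)) (N i).
  by have [c cl cN] := DP i (N i); exists c.
(* There are at most [theta < kappa] codes, so some [b] in [S] contains them all. *)
have [|b Sb codeb] := Sunb (code @` below theta).
  split; first by move=> _ [i _ <-]; apply: (codeP i).1.
  split.
    apply: (card_le_trans (card_image_le _ _)).
    exact/subset_card_le/sub_below/ltW.
  move=> /card_le_trans/(_ (card_image_le _ _)) kt; apply: (kappa_cardinal _ theta_kappa).
  by apply/card_eqPle; split=> //; apply/subset_card_le/sub_below/ltW.
have [[bl bsmall] bO [c ck bc]] := CO _ (SC _ Sb).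
have [] : (subsets_lt kappa (below lambda) `\` S) b; last by [].
apply: ES; apply: oE; split=> //; last by exists c.
have theta_lambda : theta < lambda := lt_trans theta_kappa kappa_lambda.
have btheta : b theta by apply: (bO 0 [::]).
(* [b] meets [kappa] in the ordinal [c], so with [theta] it contains every [i < theta]. *)
have theta_c : theta < c by have : (b `&` below kappa) theta by []; rewrite bc.
have b_lt_theta i : i < theta -> b i.
  move=> it; have : below c i by apply: lt_trans theta_c.
  by rewrite -bc => -[].
move=> n s sb ol.
(* Some [beta i] bounds the arguments and the value, so [N i] captures this application of [o]. *)
have [|i it si] := beta_cof (o n s :: s).
  by move=> x; rewrite inE => /orP[/eqP ->|/sb/bl].
have bi := b_lt_theta i it.
have b2 x : b x -> forall y, y \in [:: i; x] -> b y.
  by move=> bx y; rewrite !inE => /orP[]/eqP->.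
have hb x : b x -> x < beta i -> b (h i x).
  move=> bx /(hP i).1 hx; apply: (bO 1 [:: i; x] (b2 x bx)).
  exact: lt_trans hx (mu_lt i).
(* As [b] contains [i] and [code i], the operations [n.+3] put its part below [mu i] in the named
   club. *)
have bmu : clubops kappa (below (mu i)) (N i) (b `&` below (mu i)).
  apply: (codeP i).2; split.
  - split; first by move=> x [].
    have sub : b `&` below (mu i) #<= b by apply: subset_card_le => x [].
    have [bk kb] := bsmall; split; first exact: card_le_trans bk.
    by move=> /card_le_trans/(_ sub).
  - move=> m t tb Dm; split=> //; apply: (bO m.+3 [:: i, code i & t]).
      move=> x; rewrite !inE => /or3P[/eqP ->//|/eqP ->|/tb[]//].
      by apply: codeb; exists i.
    exact: lt_trans Dm (mu_lt i).
  - exists c => //; rewrite -bc; apply/seteqP; split=> x; first by move=> [[bx _] kx].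
    by move=> [bx kx]; do 2!split=> //; apply: sub_below (mu_ge i) _ kx.
have [_ /(_ n (map (h i) s)) bN _] := bmu.
(* [N i] sends the image of [s] to [h i (o n s)], and [g i] brings this back to [o n s]. *)
have gs : map (g i) (map (h i) s) = s.
  rewrite -map_comp -[RHS]map_id; apply/eq_in_map => x xs /=.
  by apply: gP; apply: si; rewrite inE xs orbT.
move: bN; rewrite /N gs => -[].
- move=> _ /mapP[x xs ->]; have xbeta : x < beta i by apply: si; rewrite inE xs orbT.
  by split; [apply: hb => //; apply: sb|apply: (hP i).1].
- by apply: (hP i).1; apply: si; rewrite mem_head.
move=> bh _; rewrite -(gP i (o n s)); last by apply: si; rewrite mem_head.
apply: (bO 2 [:: i; h i (o n s)] (b2 _ bh)).
by rewrite /= gP //; apply: si; rewrite mem_head.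
Qed.
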